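(* Let $L$ be a modular lattice such that $\operatorname{RCSub}(L)$ is a ranked lattice of finite length. Then $L$ is a $2$-distributive lattice of finite length.
   Context: Sublattices are nonempty by convention. For elements $u,x,v$ of a lattice $L$, let $\mathrm{rc}_L(u,x,v):=\{y\in L : x\wedge y=u \text{ and } x\vee y=v\}$. A sublattice $S$ of $L$ is RC-closed (closed with respect to taking relative complements) if $\mathrm{rc}_L(u,x,v)\subseteq S$ for all $u,x,v\in S$. $\operatorname{RCSub}(L)$ denotes the set consisting of the empty set and all RC-closed sublattices of $L$, ordered by set inclusion $\subseteq$; it is an algebraic lattice. The length $\operatorname{len}(K)$ of a lattice $K$ is the supremum of the lengths of its finite chains, where a finite chain $C$ has length $|C|-1$; $K$ is of finite length if $\operatorname{len}(K)$ is finite. A ranked lattice is a lattice in which any two maximal chains of every principal ideal are of the same finite length. A lattice $L$ is $n$-distributive if for all $x,y_0,\dots,y_n\in L$, $x\wedge\bigvee\{y_i : 0\leq i\leq n\}=\bigvee_{j=0}^n\bigl(x\wedge\bigvee\{y_i : 0\leq i\leq n,\ i\neq j\}\bigr)$; $2$-distributive means this holds with $n=2$. *)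

(* Defs.v *)
From HB Require Import structures.
From mathcomp Require Import all_boot all_order.
From mathcomp Require Import boolp classical_sets functions cardinality.

Set Implicit Arguments.
Unset Strict Implicit.
Unset Printing Implicit Defensive.

Import Order.TTheory.

Local Open Scope classical_set_scope.
Local Open Scope card_scope.

Section Length.
Context {d : Order.disp_t} {T : porderType d}.
Implicit Types C D X : set T.

Definition chain C : Prop := total_on C (fun x y => (x <= y)%O).

(* A finite chain of length n has n + 1 elements; the empty chain has no length. *)
Definition has_length C (n : nat) : Prop := C #= `I_n.+1.

Definition maximal_chain X C : Prop :=
  [/\ chain C, C `<=` X &
      forall D, chain D -> D `<=` X -> C `<=` D -> D = C].

Definition principal_ideal (a : T) : set T := [set x | (x <= a)%O].

End Length.

Definition chain_lengths d (T : porderType d) : set nat :=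
  [set n | exists2 C : set T, chain C & has_length C n].

(* len T, the supremum of chain_lengths T in nat with infinity, is finite. *)
Definition finite_length d (T : porderType d) : Prop :=
  has_ubound (chain_lengths T).

Definition ranked d (T : latticeType d) : Prop :=
  forall (a : T) (C D : set T),
    maximal_chain (principal_ideal a) C -> maximal_chain (principal_ideal a) D ->
    exists n, has_length C n /\ has_length D n.

Definition modular d (T : latticeType d) : Prop :=
  forall x y z : T, (x <= z -> x `|` (y `&` z) = (x `|` y) `&` z)%O.

Definition two_distributive d (T : latticeType d) : Prop :=
  forall x y0 y1 y2 : T,
    (x `&` (y0 `|` y1 `|` y2) =
     (x `&` (y1 `|` y2)) `|` (x `&` (y0 `|` y2)) `|` (x `&` (y0 `|` y1)))%O.

Section RelativeComplements.
Context {d : Order.disp_t} {L : latticeType d}.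
Implicit Types S A B : set L.

Definition rc (u x v : L) : set L :=
  [set y | (x `&` y)%O = u /\ (x `|` y)%O = v].

Definition sublattice S : Prop :=
  [/\ S !=set0,
      (forall x y, S x -> S y -> S (x `&` y)%O) &
      (forall x y, S x -> S y -> S (x `|` y)%O)].

Definition rc_closed S : Prop :=
  forall u x v, S u -> S x -> S v -> rc u x v `<=` S.

Definition is_rcsub S : Prop := S = set0 \/ (sublattice S /\ rc_closed S).

Lemma is_rcsubP S : is_rcsub S <->
  [/\ (forall x y, S x -> S y -> S (x `&` y)%O),
      (forall x y, S x -> S y -> S (x `|` y)%O) & rc_closed S].
Proof.
split=> [[->|[[_ SI SU] Src]]|[SI SU Src]]; [by split | by split |].
by have [->|/set0P S0] := eqVneq S set0; [left | right; split].
Qed.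

Lemma is_rcsub_bigcap (F : set (set L)) :
  F `<=` is_rcsub -> is_rcsub (\bigcap_(S in F) S).
Proof.
move=> Frc; apply/is_rcsubP; split=> [x y Sx Sy S FS|x y Sx Sy S FS|].
- by have /is_rcsubP[SI _ _] := Frc _ FS; apply: SI; [apply: Sx | apply: Sy].
- by have /is_rcsubP[_ SU _] := Frc _ FS; apply: SU; [apply: Sx | apply: Sy].
- move=> u x v Su Sx Sv y xy S FS; have /is_rcsubP[_ _ Src] := Frc _ FS.
  by apply: (Src u x v) xy; [apply: Su | apply: Sx | apply: Sv].
Qed.

Lemma is_rcsubI A B : is_rcsub A -> is_rcsub B -> is_rcsub (A `&` B).
Proof.
move=> rcA rcB; rewrite -bigcap2inE -(bigcap_image _ (bigcap2 A B) id).
by apply: is_rcsub_bigcap => _ [[|[|//]] _ <-].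
Qed.

Lemma is_rcsub_smallest A : is_rcsub (smallest is_rcsub A).
Proof. by apply: is_rcsub_bigcap => S []. Qed.

End RelativeComplements.

Record RCSub d (L : latticeType d) := MkRCSub {
  rcsub_set :> set L;
  rcsub_setP : `[< is_rcsub rcsub_set >]
}.

Section RCSubLattice.
Context {d : Order.disp_t} {L : latticeType d}.

HB.instance Definition _ := [isSub for @rcsub_set d L].
HB.instance Definition _ := [Choice of RCSub L by <:].
(* The order induced from set L, i.e., inclusion. *)
HB.instance Definition _ :=
  [SubChoice_isSubPOrder of RCSub L by <: with set_display].

Implicit Types S : RCSub L.

Lemma rcsub_leE S1 S2 : (S1 <= S2)%O = (rcsub_set S1 `<=` S2) :> Prop.
Proof. by rewrite -subsetEset. Qed.

Definition rcsub_meet S1 S2 : RCSub L :=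
  MkRCSub (asboolT (is_rcsubI (asboolW (rcsub_setP S1)) (asboolW (rcsub_setP S2)))).

Definition rcsub_join S1 S2 : RCSub L :=
  MkRCSub (asboolT (is_rcsub_smallest (rcsub_set S1 `|` S2))).

Lemma rcsub_lexI S S1 S2 : (S <= rcsub_meet S1 S2)%O = (S <= S1)%O && (S <= S2)%O.
Proof.
by apply/idP/andP; rewrite !rcsub_leE subsetI.
Qed.

Lemma rcsub_leUx S1 S2 S : (rcsub_join S1 S2 <= S)%O = (S1 <= S)%O && (S2 <= S)%O.
Proof.
apply/idP/andP; rewrite !rcsub_leE /=.
  by move=> SS; rewrite -subUset; apply: subset_trans SS;
  exact: sub_gen_smallest.
move=> [S1S S2S]; apply: smallest_sub; first exact: (asboolW (rcsub_setP S)).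
by rewrite subUset.
Qed.

HB.instance Definition _ := Order.POrder_MeetJoin_isLattice.Build set_display
  (RCSub L) rcsub_lexI rcsub_leUx.

End RCSubLattice.

(* Main.v *)
Require Import Defs.
From mathcomp Require Import all_boot all_order.
From mathcomp Require Import boolp classical_sets functions cardinality.

(** A convex sublattice contains every relative complement [y] of its elements,
    since [u <= y <= v].  The principal ideals of [L] are convex, so the chains
    of [L] embed into [RCSub L] ([finite_length_of_RCSub]), and [L] inherits
    finite length.

    Suppose that a modular lattice of finite length is not 2-distributive.
    Then it has an interval [[o, e]] of length 3, a projective plane, with four
    atoms any three of which join to [e] ([failure_quadrangle]).  Indeed, let
    [w < v] be the two sides of a failing instance and take an [x] that covers
    [w] below [v].  Over [w], this [x] is an atom under the join of three
    elements but under no join of two of them.  Each of the three is replaced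
    by its meet with the join of [x] and the two others; then the pairwise joins
    are coatoms under the total join [e].  Their meet is [o], and the four atoms
    are the pairwise meets of the coatoms together with [x `|` o].

    In such a plane every RC-closed sublattice that contains [o], [e] and some
    third element is the whole of [[o, e]] ([quadrangle_mem]).  The sublattice
    contains a point [p], because the points off a line are complements of that
    line.  It then contains every line avoiding [p].  A vertex of the quadrangle
    other than [p] is the meet of two such lines, because the three sides
    through the vertex are distinct and [p] is on at most one of them.  So the
    sublattice contains all the vertices, then all lines, then all points.

    Hence the empty set, [{o}], [{o, e}], [[o, e]] is a maximal chain below
    [[o, e]] in [RCSub L].  The intervals from [o] along a maximal chain of the
    plane, with the empty set, form a chain with five elements, so [RCSub L] is
    not ranked ([quadrangle_not_ranked]). *)

Set Implicit Arguments.
Unset Strict Implicit.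
Unset Printing Implicit Defensive.

Import Order.TTheory.

Local Open Scope order_scope.

(** Whitman's rules for inequalities between lattice terms, with the hypotheses
    as the axioms about generators. *)
Ltac lat :=
  solve [ assumption | exact: lexx | exact: ltW
        | rewrite leUx; apply/andP; split; lat
        | rewrite lexI; apply/andP; split; lat
        | apply: lexUl; lat | apply: lexUr; lat
        | apply: leIxl; lat | apply: leIxr; lat ].

Ltac lateq := apply/le_anti; apply/andP; split; lat.

Definition covers d (T : porderType d) (x y : T) : Prop :=
  x < y /\ forall z, x <= z -> z <= y -> z = x \/ z = y.

(** * Coverings in modular lattices *)

Section Covers.
Context {d : Order.disp_t} {L : latticeType d}.
Implicit Types x y z a b : L.

Lemma covers_le x y : covers x y -> x <= y.
Proof. by case=> /ltW. Qed.

Lemma covers_not_between x y z : covers x y -> x < z -> z < y -> False.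
Proof.
move=> [_ xy] xz zy; have [zE|zE] := xy z (ltW xz) (ltW zy).
- by rewrite zE ltxx in xz.
- by rewrite zE ltxx in zy.
Qed.

Lemma covers_eq x y z : covers x y -> covers x z -> y <= z -> y = z.
Proof.
move=> [xy _] [_ xz] yz; have [yE|//] := xz y (ltW xy) yz.
by rewrite yE ltxx in xy.
Qed.

Lemma covers_meet x y a : covers x y -> x <= a -> ~~ (y <= a) -> a `&` y = x.
Proof.
move=> [xy cov] xa ya; have [||//|yE] := cov (a `&` y); [lat|lat|].
by case/negP: ya; rewrite -yE; lat.
Qed.

Lemma covers_join x y a : covers x y -> a <= y -> ~~ (a <= x) -> x `|` a = y.
Proof.
move=> [xy cov] ay ax; have [||xE|//] := cov (x `|` a); [lat|lat|].
by case/negP: ax; rewrite -xE; lat.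
Qed.

Hypothesis L_modular : modular L.

(** In a modular lattice the maps [z |-> y `&` z] and [z |-> x `|` z] are inverse
    isomorphisms between [[x, x `|` y]] and [[x `&` y, y]]; in particular, one of
    these intervals is a covering if and only if the other is. *)
Lemma covers_transpose_up x y : covers (x `&` y) y -> covers x (x `|` y).
Proof.
move=> [lt_y cov]; split.
  rewrite lt_neqAle leUl andbT; apply/eqP => xE.
  suff yE : x `&` y = y by rewrite yE ltxx in lt_y.
  by rewrite xE; lateq.
move=> z xz zy.
have zE : x `|` (y `&` z) = z by rewrite L_modular // meet_r.
have [||yz|yz] := cov (y `&` z); [lat|lat| |].
- by left; rewrite -zE yz; lateq.
- by right; rewrite -[LHS]zE yz.
Qed.

Lemma covers_transpose_down x y : covers x (x `|` y) -> covers (x `&` y) y.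
Proof.
move=> [lt_x cov]; split.
  rewrite lt_neqAle leIr andbT; apply/eqP => yE.
  suff xE : x `|` y = x by rewrite xE ltxx in lt_x.
  by rewrite -yE; lateq.
move=> z xz zy.
have zE : (z `|` x) `&` y = z by rewrite -L_modular // join_l.
have [||yz|yz] := cov (z `|` x); [lat|lat| |].
- by left; rewrite -zE yz.
- by right; rewrite -zE yz; lateq.
Qed.

(** All maximal chains of an interval of length 2 have length 2: an element
    incomparable with [a] is a complement of [a], and both of its coverings are
    transposes of those of [a]. *)
Lemma length2_cases o a b x :
    covers o a -> covers a b -> o <= x -> x <= b ->
  [\/ x = o, covers o x /\ covers x b | x = b].
Proof.
move=> oa ab ox xb; have oa_le := covers_le oa; have ab_le := covers_le ab.
have [ax|nax] := boolP (a <= x).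
  by have [->|->] := ab.2 x ax xb; [apply: Or32|apply: Or33].
have xaE := covers_meet oa ox nax.
have [xa|nxa] := boolP (x <= a).
  by apply: Or31; rewrite -xaE meet_l.
have axE := covers_join ab xb nxa.
apply: Or32; split.
- by rewrite -xaE meetC; apply: covers_transpose_down; rewrite axE.
- by rewrite -axE joinC; apply: covers_transpose_up; rewrite xaE.
Qed.

End Covers.

(** * Points and lines in an interval of length 3 *)

Section Plane.
Context {d : Order.disp_t} {L : latticeType d}.
Variables o e : L.
Implicit Types p q l k x a b c : L.

Definition is_point q : Prop := covers o q /\ q <= e.
Definition is_line l : Prop := o <= l /\ covers l e.
Definition plane : Prop :=
  exists a b, [/\ covers o a, covers a b & covers b e].

Lemma point_ge p : is_point p -> o <= p.
Proof. by case=> /covers_le. Qed.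

Lemma line_le l : is_line l -> l <= e.
Proof. by case=> _ /covers_le. Qed.

Lemma meet_point p a : is_point p -> o <= a -> ~~ (p <= a) -> a `&` p = o.
Proof. by case=> op _; exact: covers_meet. Qed.

Lemma join_line l a : is_line l -> a <= e -> ~~ (a <= l) -> l `|` a = e.
Proof. by case=> _ le; exact: covers_join. Qed.

Hypotheses (L_modular : modular L) (oe_plane : plane).

(** Otherwise [[o, e]] would also have the maximal chain [o < x < e] of length 2,
    against the Jordan-Hoelder property. *)
Lemma point_not_line x : is_point x -> is_line x -> False.
Proof.
move=> [ox xe] [_ xce]; have [a [b [oa ab be]]] := oe_plane.
have ae : a < e by apply: lt_trans ab.1 be.1.
have [ax|nax] := boolP (a <= x).
  rewrite (covers_eq oa ox ax) in ab.
  exact: covers_not_between xce ab.1 be.1.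
have xE := covers_join xce (ltW ae) nax.
have xaE := covers_meet oa (covers_le ox) nax.
apply: (covers_not_between _ ab.1 be.1); rewrite -xE joinC.
by apply: covers_transpose_up => //; rewrite meetC xaE.
Qed.

(** An interval of length 3 has only the ranks 0 to 3.  Off the coatom [b], the
    element [x] has the rank of [b `&` x] plus one, by transposition. *)
Lemma plane_cases x :
  o <= x -> x <= e -> [\/ x = o, is_point x, is_line x | x = e].
Proof.
move=> ox xe; have [a [b [oa ab be]]] := oe_plane.
have ob : o <= b by apply: le_trans (covers_le oa) (covers_le ab).
have [xb|nxb] := boolP (x <= b).
  have [->|[ox' _]|->] := length2_cases L_modular oa ab ox xb.
  - exact: Or41.
  - exact: Or42.
  - exact: Or43.
have bxE := covers_join be xe nxb.
have [||bxo|[_ bxb]|bxb] := length2_cases L_modular oa ab _ _ (x := b `&` x).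
- by lat.
- by lat.
- apply: Or42; split=> //; rewrite -bxo.
  by apply: covers_transpose_down; rewrite ?bxE.
- apply: Or43; split=> //; rewrite -bxE joinC.
  by apply: covers_transpose_up; rewrite // meetC.
- have bx : b <= x by rewrite -bxb; lat.
  by have [->|->] := be.2 x bx xe; [apply: Or43|apply: Or44].
Qed.

Lemma line_lt_e l : is_line l -> l = e -> False.
Proof. by move=> [_ [le _]] lE; rewrite lE ltxx in le. Qed.

Lemma join_points p q : is_point p -> is_point q -> p <> q -> is_line (p `|` q).
Proof.
move=> pp pq pNq.
have npq : ~~ (p <= q) by apply/negP => /(covers_eq pp.1 pq.1).
have nqp : ~~ (q <= p) by apply/negP => /(covers_eq pq.1 pp.1) /esym.
have pqE := meet_point pp (point_ge pq) npq.
have q_pq : covers q (q `|` p).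
  by apply: covers_transpose_up => //; rewrite pqE; case: pp.
have [opE ope] := (point_ge pp, pp.2); have qe := pq.2.
have [||pqo|ppq|//|pqe] := @plane_cases (p `|` q); [lat|lat| | |].
- by case/negP: nqp; rewrite (le_trans _ opE) // -pqo; lat.
- case: (covers_not_between ppq.1 pq.1.1).
  by rewrite joinC; case: q_pq.
- case: (point_not_line pq); split; first exact: point_ge.
  by rewrite -pqe joinC.
Qed.

Lemma meet_lines l k : is_line l -> is_line k -> l <> k -> is_point (l `&` k).
Proof.
move=> ll lk lNk.
have nkl : ~~ (k <= l).
  apply/negP => kl; have [lE|lE] := lk.2.2 l kl (line_le ll) => //.
  exact: line_lt_e ll lE.
have nlk : ~~ (l <= k).
  apply/negP => lk'; have [lE|lE] := ll.2.2 k lk' (line_le lk).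
  - exact: lNk.
  - exact: line_lt_e lk lE.
have lkE := join_line ll (line_le lk) nkl.
have lk_k : covers (l `&` k) k.
  by apply: covers_transpose_down => //; rewrite lkE; case: ll.
have [ol ok] := (ll.1, lk.1); have [le ke] := (line_le ll, line_le lk).
have [||lko|//|llk|lke] := @plane_cases (l `&` k); [lat|lat| | |].
- by case: (@point_not_line k) => //; split=> //; rewrite -lko.
- case: (covers_not_between llk.2 lk_k.1); by case: lk => _ [].
- by case/negP: nlk; rewrite (le_trans le) // -lke; lat.
Qed.

Lemma point_eq p q : is_point p -> is_point q -> p <= q -> p = q.
Proof. by move=> [op _] [oq _]; exact: covers_eq op oq. Qed.

(** If [a] and [b] were equal, then [a `|` c] would be [e], but the join of two
    points has rank at most 2. *)
Lemma noncollinear_neq a b c :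
  is_point a -> is_point b -> is_point c -> a `|` b `|` c = e -> a <> b.
Proof.
move=> pa pb pc abcE abE; rewrite -abE joinxx in abcE.
have [ac|/eqP ac] := eqVneq a c.
  rewrite -ac joinxx in abcE; have [x [y [ox xy ye]]] := oe_plane.
  case: (@covers_not_between _ _ o a x pa.1 ox.1).
  by rewrite abcE; exact: lt_trans xy.1 ye.1.
by apply: (line_lt_e (join_points pa pc ac)).
Qed.

(** * Relative complements in a projective plane *)

Section Generation.
Variable S : set L.
Hypotheses (S_rc : is_rcsub S) (So : S o) (Se : S e).

Let S_meet x y : S x -> S y -> S (x `&` y).
Proof. by have /is_rcsubP[SI _ _] := S_rc; exact: SI. Qed.

Lemma complement_mem x y : S x -> x `&` y = o -> x `|` y = e -> S y.
Proof.
have /is_rcsubP[_ _ Src] := S_rc.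
by move=> Sx xyo xye; apply: (Src o x e).
Qed.

Lemma line_mem p l : S p -> is_point p -> is_line l -> ~~ (p <= l) -> S l.
Proof.
move=> Sp pp ll pl; apply: (complement_mem Sp).
- by rewrite meetC; apply: meet_point => //; case: ll.
- by rewrite joinC; apply: join_line => //; case: pp.
Qed.

(** The sides joining [a] to the three other vertices are distinct lines through
    [a].  At most one passes through a point [p] other than [a]; the two others
    are complements of [p] and meet in [a]. *)
Lemma vertex_mem p a b c f : S p -> is_point p ->
    is_point a -> is_point b -> is_point c -> is_point f ->
    a `|` b `|` c = e -> a `|` b `|` f = e -> a `|` c `|` f = e -> S a.
Proof.
move=> Sp pp pa pb pc pf abc abf acf.
have [<-//|/eqP pNa] := eqVneq p a.
have ab : is_line (a `|` b).
  by apply: join_points => //; exact: noncollinear_neq abc.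
have ac : is_line (a `|` c).
  by apply: join_points => //; exact: noncollinear_neq acf.
have af : is_line (a `|` f).
  apply: join_points => //; apply: (@noncollinear_neq _ _ b) => //.
  by rewrite joinAC.
have key x y : is_point x -> is_point y ->
    is_line (a `|` x) -> is_line (a `|` y) -> a `|` x `|` y = e ->
    (a `|` x) `&` (a `|` y) = a /\ ~~ ((p <= a `|` x) && (p <= a `|` y)).
  move=> px py ax ay axy.
  have axNay : a `|` x <> a `|` y.
    move=> axE; apply: (line_lt_e ay); rewrite -axy axE.
    by lateq.
  have m := meet_lines ax ay axNay.
  have aE : a = (a `|` x) `&` (a `|` y) by apply: point_eq => //; lat.
  split=> //; rewrite -lexI -aE; apply/negP => /(point_eq pp pa).
  exact: pNa.
have finish x y : is_point x -> is_point y ->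
    is_line (a `|` x) -> is_line (a `|` y) -> a `|` x `|` y = e ->
    ~~ (p <= a `|` x) -> ~~ (p <= a `|` y) -> S a.
  move=> px py ax ay axy nx ny; have [<- _] := key _ _ px py ax ay axy.
  by apply: S_meet; apply: (line_mem Sp pp).
have [pab|npab] := boolP (p <= a `|` b).
- have [_] := key _ _ pb pc ab ac abc; rewrite pab /= => npac.
  have [_] := key _ _ pb pf ab af abf; rewrite pab /= => npaf.
  exact: (finish c f).
- have [pac|npac] := boolP (p <= a `|` c); last exact: (finish b c).
  have [_] := key _ _ pc pf ac af acf; rewrite pac /= => npaf.
  exact: (finish b f).
Qed.

(** A line misses some vertex of the triangle, hence is a complement of it.  A
    point [q] off the vertices is the meet of two of the lines joining it to
    them, which are not all equal because no line contains the triangle. *)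
Lemma triangle_mem a b c : is_point a -> is_point b -> is_point c ->
    a `|` b `|` c = e -> S a -> S b -> S c ->
  forall x, o <= x -> x <= e -> S x.
Proof.
move=> pa pb pc abc Sa Sb Sc.
have Sline l : is_line l -> S l.
  move=> ll.
  have [al|] := boolP (a <= l); last exact: line_mem.
  have [bl|] := boolP (b <= l); last exact: line_mem.
  have [cl|] := boolP (c <= l); last exact: line_mem.
  case: (line_lt_e ll); apply/le_anti; rewrite (line_le ll) -abc /=.
  by lat.
have Spoint q : is_point q -> S q.
  move=> pq.
  have [->//|/eqP qa] := eqVneq q a.
  have [->//|/eqP qb] := eqVneq q b.
  have [->//|/eqP qc] := eqVneq q c.
  have [la lb lc] := And3 (join_points pq pa qa) (join_points pq pb qb)
                          (join_points pq pc qc).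
  have Sm k l : is_line k -> is_line l -> q <= k -> q <= l -> k <> l -> S q.
    move=> lk ll qk ql kl.
    suff -> : q = k `&` l by apply: S_meet; exact: Sline.
    by apply: point_eq => //; [exact: meet_lines|lat].
  have [abE|/eqP abN] := eqVneq (q `|` a) (q `|` b); last first.
    by apply: (Sm _ _ la lb) => //; lat.
  have [acE|/eqP acN] := eqVneq (q `|` a) (q `|` c); last first.
    by apply: (Sm _ _ la lc) => //; lat.
  case: (line_lt_e la); apply/le_anti; rewrite (line_le la) -abc /=.
  by rewrite !leUx leUr {1}abE acE !leUr.
move=> x ox xe; have [->//||| ->//] := plane_cases ox xe.
- exact: Spoint.
- exact: Sline.
Qed.

Variables a b c f : L.
Hypotheses (pa : is_point a) (pb : is_point b).
Hypotheses (pc : is_point c) (pf : is_point f).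
Hypotheses (abc : a `|` b `|` c = e) (abf : a `|` b `|` f = e)
  (acf : a `|` c `|` f = e) (bcf : b `|` c `|` f = e).

(** The interval [[o, e]] is generated over its bounds by any one of its other
    elements.  If that element is a line, the vertices off the line are
    complements of it, so that a point is available in both cases. *)
Lemma quadrangle_mem x : o < x -> x < e -> S x ->
  forall y, o <= y -> y <= e -> S y.
Proof.
move=> ox xe Sx.
have [p pp Sp] : exists2 p, is_point p & S p.
  have [xE|px|lx|xE] := plane_cases (ltW ox) (ltW xe).
  - by rewrite xE ltxx in ox.
  - by exists x.
  - have Sq q : is_point q -> ~~ (q <= x) -> exists2 p, is_point p & S p.
      move=> pq nqx; exists q => //; apply: (complement_mem Sx).
      + by apply: meet_point => //; case: lx.
      + by apply: join_line => //; case: pq.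
    have [ax|] := boolP (a <= x); last exact: Sq.
    have [bx|] := boolP (b <= x); last exact: Sq.
    have [cx|] := boolP (c <= x); last exact: Sq.
    case: (line_lt_e lx); apply/le_anti; rewrite (line_le lx) -abc /=.
    by lat.
  - by rewrite xE ltxx in xe.
have V := @vertex_mem p.
apply: (triangle_mem pa pb pc abc).
- exact: (V a b c f).
- by apply: (V b a c f) => //; rewrite (joinC b a).
- by apply: (V c a b f) => //; rewrite -1?(joinC b c) // -?(joinC a c) // joinAC.
Qed.

End Generation.
End Plane.

(** * Chains and finite length *)

Section SortedChains.
Context {d : Order.disp_t} {T : porderType d}.
Implicit Types s : seq T.

Lemma chain_sorted s : sorted <%O s -> chain [set` s]%classic.
Proof.
move=> s_lt x y /= xs ys; have nth_le := lt_sorted_leq_nth x s_lt.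
rewrite -(nth_index x xs) -(nth_index x ys) !nth_le ?inE ?index_mem //.
by apply/orP; exact: leq_total.
Qed.

Lemma card_sorted s : sorted <%O s -> ([set` s] #= `I_(size s))%card.
Proof.
case: s => [|x s] s_lt; first by rewrite set_nil II0 card_eq00.
have -> : [set` x :: s]%classic = (nth x (x :: s) @` `I_(size (x :: s)))%classic.
  apply/seteqP; split=> [y /= ys|_ [i /= i_lt <-]]; last exact: mem_nth.
  by exists (index y (x :: s)); [move: ys; rewrite -index_mem|exact: nth_index].
apply: inj_card_eq => i j; rewrite !inE => i_lt j_lt /eqP.
by rewrite nth_uniq ?(lt_sorted_uniq s_lt) // => /eqP.
Qed.

(** Zorn's lemma is applied to the sets whose union with [C] is a chain, rather
    than to the chains above [C]: then the empty union is no exception. *)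
Lemma maximal_chain_extends (X C : set T) :
    (C `<=` X)%classic -> chain C ->
  exists2 D : set T, (C `<=` D)%classic & maximal_chain X D.
Proof.
move=> CX C_chain.
pose P (D : set T) := chain (C `|` D)%classic /\ (D `<=` X)%classic.
have [|D [[CD_chain DX] D_max]] := @Zorn_bigcup T P.
  move=> F FP F_tot; split; last by move=> x [D FD Dx]; apply: (FP D FD).2.
  have F_chain D x y : F D -> (C x \/ D x) -> (C y \/ D y) ->
      x <= y \/ y <= x by move=> /FP[CD _]; exact: CD.
  move=> x y [Cx|[D FD Dx]] [Cy|[E FE Ey]].
  - exact: C_chain.
  - by apply: (F_chain E) => //; [left|right].
  - by apply: (F_chain D) => //; [right|left].
  - have [DE|ED] := F_tot _ _ FD FE.
    + by apply: (F_chain E) => //; right=> //; exact: DE.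
    + by apply: (F_chain D) => //; right=> //; exact: ED.
exists (C `|` D)%classic; first exact: subsetUl.
split=> // [x [/CX|/DX] //|D' D'_chain D'X CDD'].
apply: contrapT => D'N; apply: (D_max D').
  split=> [x Dx|D'D]; first by apply: CDD'; right.
  by apply: D'N; apply/seteqP; split=> // x /D'D; right.
split=> // x y; rewrite /setU /= => Cx Cy; apply: D'_chain.
- by case: Cx => // Cx; apply: CDD'; left.
- by case: Cy => // Cy; apply: CDD'; left.
Qed.

Hypothesis T_finite : finite_length T.

(** Otherwise below every element of the half-open interval from [w] to [u] there
    is a smaller one, which gives strictly decreasing sequences, and thus chains,
    of any length. *)
Lemma exists_cover (w u : T) : w < u -> exists2 x, covers w x & x <= u.
Proof.
move=> wu; apply: contrapT => no_cover.
pose X := {x : T | w < x <= u}.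
have step (x : X) : {y : X | val y < val x}.
  apply: cid; apply: contrapT => no_y; have /andP[wx xu] := valP x.
  apply: no_cover; exists (val x) => //; split=> // z wz zx.
  have [->|zNw] := eqVneq z w; first by left.
  right; apply/eqP; apply: contrapT => /negP zNx; apply: no_y.
  have z_in : w < z <= u.
    by rewrite lt_neqAle eq_sym zNw wz (le_trans zx).
  by exists (exist _ z z_in) => /=; rewrite lt_neqAle zNx.
have u_in : w < u <= u by rewrite wu lexx.
have [f [_ f_dec]] := dependent_choice step (exist _ u u_in).
have [M M_ub] := T_finite.
pose s := rev (mkseq (val \o f) M.+2).
have s_size : size s = M.+2 by rewrite size_rev size_mkseq.
have s_lt : sorted <%O s.
  rewrite rev_sorted; apply/(sortedP u) => i; rewrite size_mkseq => i_lt.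
  by rewrite !nth_mkseq //=; [exact: f_dec|exact: ltnW].
suff : (M.+1 <= M)%N by rewrite ltnn.
rewrite -leEnat; apply: M_ub.
exists [set` s]%classic; first exact: chain_sorted.
by rewrite /has_length -s_size; exact: card_sorted.
Qed.

End SortedChains.

(** * RC-closed sublattices *)

Section RCSubFacts.
Context {d : Order.disp_t} {L : latticeType d}.
Implicit Types x y o e : L.

(** A relative complement of [x] in [[u, v]] lies between [u] and [v]. *)
Lemma convex_sublattice_is_rcsub (S : set L) :
    (forall x y, S x -> S y -> S (x `&` y)) ->
    (forall x y, S x -> S y -> S (x `|` y)) ->
    (forall x y z, S x -> S z -> x <= y -> y <= z -> S y) -> is_rcsub S.
Proof.
move=> SI SU S_conv; apply/is_rcsubP; split=> // u x v Su Sx Sv y [yu yv].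
by apply: (S_conv u y v) => //; rewrite -?yu -?yv; lat.
Qed.

Definition rcsub (S : set L) (S_rc : is_rcsub S) : RCSub L :=
  MkRCSub (asboolT S_rc).

Lemma rcsub_inj (S1 S2 : RCSub L) : rcsub_set S1 = rcsub_set S2 -> S1 = S2.
Proof. exact: val_inj. Qed.

Lemma rcsub_ltP (S1 S2 : RCSub L) x :
  (rcsub_set S1 `<=` S2)%classic ->
  rcsub_set S2 x -> ~ rcsub_set S1 x -> S1 < S2.
Proof.
move=> S12 S2x nS1x; rewrite lt_neqAle; apply/andP; split.
  by apply/eqP => SE; apply: nS1x; rewrite SE.
by rewrite rcsub_leE.
Qed.

Lemma down_is_rcsub x : is_rcsub [set y | y <= x]%classic.
Proof.
apply: convex_sublattice_is_rcsub => /= [y z yx zx|y z yx zx|y z t _ tx _ zt].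
- by lat.
- by lat.
- exact: le_trans tx.
Qed.

Lemma itv_is_rcsub x y : is_rcsub [set z | x <= z <= y]%classic.
Proof.
apply: convex_sublattice_is_rcsub => /= [a b|a b|a b c].
- by move=> /andP[? ?] /andP[? ?]; apply/andP; split; lat.
- by move=> /andP[? ?] /andP[? ?]; apply/andP; split; lat.
- move=> /andP[xa _] /andP[_ cy] ab bc.
  by rewrite (le_trans xa) // (le_trans bc).
Qed.

(** If [x] has a relative complement in [[u, v]] then [u <= x <= v].  When these
    three are [o] or [e], [x] is a bound of [[u, v]], and its only complement
    there is the other bound. *)
Lemma pair_is_rcsub o e : o <= e -> is_rcsub [set x | x = o \/ x = e]%classic.
Proof.
move=> oe; apply/is_rcsubP; split=> /=.
- by move=> x y [->|->] [->|->];
    rewrite ?meetxx ?(meet_l oe) ?(meet_r oe); [left|left|left|right].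
- by move=> x y [->|->] [->|->];
    rewrite ?joinxx ?(join_l oe) ?(join_r oe); [left|right|right|right].
- move=> u x v u_in x_in v_in y [xyu xyv].
  have [eo oy] : (e <= o -> o = e) /\ (x <= y -> y = v) /\ (y <= x -> y = u).
    split; first by move=> eo; apply/le_anti/andP.
    by rewrite -xyu -xyv; split=> [/join_r|/meet_r].
  case: x_in => xE; subst x.
  + suff oy' : o <= y by rewrite (oy.1 oy').
    suff <- : u = o by rewrite -xyu; lat.
    by case: u_in => // uE; rewrite uE -eo // -uE -xyu; lat.
  + suff ye : y <= e by rewrite (oy.2 ye).
    suff <- : v = e by rewrite -xyv; lat.
    by case: v_in => // vE; rewrite vE eo // -vE -xyv; lat.
Qed.

End RCSubFacts.

Lemma finite_length_of_RCSub d (L : latticeType d) :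
  finite_length (RCSub L) -> finite_length L.
Proof.
move=> [M M_ub]; exists M => n [C C_chain C_n]; apply: M_ub.
pose f (x : L) := rcsub (down_is_rcsub x).
exists (f @` C)%classic.
  move=> _ _ [x Cx <-] [y Cy <-].
  have f_homo u v : u <= v -> f u <= f v.
    by move=> uv; rewrite rcsub_leE => z /= /le_trans; apply.
  by case: (C_chain x y Cx Cy) => /f_homo; [left|right].
apply: card_eq_trans C_n; apply: inj_card_eq => x y _ _ fxy.
have xx : rcsub_set (f x) x by exact: lexx.
have yy : rcsub_set (f y) y by exact: lexx.
by apply/le_anti/andP; split; [rewrite fxy in xx|rewrite -fxy in yy].
Qed.

(** * A quadrangle from a failure of 2-distributivity *)

Definition quadrangle d (L : latticeType d) (o e a b c f : L) : Prop :=
  [/\ plane o e,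
      [/\ is_point o e a, is_point o e b, is_point o e c & is_point o e f] &
      [/\ a `|` b `|` c = e, a `|` b `|` f = e,
          a `|` c `|` f = e & b `|` c `|` f = e]].

Section Failure.
Context {d : Order.disp_t} {L : latticeType d}.
Hypothesis L_modular : modular L.
Implicit Types w x y z : L.

(** Write [Y0], [Y1], [Y2] for the pairwise joins of the [y]s and [e] for the join
    of all.  Each [Yi] is a coatom of [e] as a transpose of the covering of [w]
    by [x], and the [Yi] are independent: each joins with the meet of the two
    others to [e].  Hence their meet [o] has corank 3. *)
Lemma coatoms_quadrangle w x y0 y1 y2 :
    covers w x -> w <= y0 -> w <= y1 -> w <= y2 ->
    ~~ (x <= y1 `|` y2) -> ~~ (x <= y0 `|` y2) -> ~~ (x <= y0 `|` y1) ->
    x `|` (y1 `|` y2) = y0 `|` y1 `|` y2 ->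
    x `|` (y0 `|` y2) = y0 `|` y1 `|` y2 ->
    x `|` (y0 `|` y1) = y0 `|` y1 `|` y2 ->
  exists o e a b c f : L, quadrangle o e a b c f.
Proof.
move=> wx wy0 wy1 wy2 nx0 nx1 nx2.
set e := y0 `|` y1 `|` y2 => xY0 xY1 xY2.
pose Y0 := y1 `|` y2; pose Y1 := y0 `|` y2; pose Y2 := y0 `|` y1.
have coatom Y : w <= Y -> ~~ (x <= Y) -> x `|` Y = e -> covers Y e.
  move=> wY xY <-; rewrite joinC; apply: covers_transpose_up => //.
  by rewrite (covers_meet wx wY xY).
have Y0e : covers Y0 e by apply: coatom => //; rewrite /Y0; lat.
have Y1e : covers Y1 e by apply: coatom => //; rewrite /Y1; lat.
have Y2e : covers Y2 e by apply: coatom => //; rewrite /Y2; lat.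
pose o := Y0 `&` Y1 `&` Y2.
have wo : w <= o by rewrite /o /Y0 /Y1 /Y2; lat.
have J01 : Y1 `|` Y0 = e by rewrite /Y0 /Y1 /e; lateq.
have P0 : Y0 `|` (Y1 `&` Y2) = e.
  by apply/le_anti/andP; rewrite /Y0 /Y1 /Y2 /e; split; lat.
have P1 : Y1 `|` (Y0 `&` Y2) = e.
  by apply/le_anti/andP; rewrite /Y0 /Y1 /Y2 /e; split; lat.
have P2 : Y2 `|` (Y0 `&` Y1) = e.
  by apply/le_anti/andP; rewrite /Y0 /Y1 /Y2 /e; split; lat.
have down u v : covers u e -> u `|` v = e -> covers (u `&` v) v.
  by move=> ue uv; apply: covers_transpose_down; rewrite ?uv.
have o2 : covers o (Y0 `&` Y1) by rewrite /o meetC; exact: down.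
have o1 : covers o (Y0 `&` Y2) by rewrite /o meetAC meetC; exact: down.
have o0 : covers o (Y1 `&` Y2) by rewrite /o -meetA; exact: down.
have ox : covers o (o `|` x).
  apply: covers_transpose_up => //; rewrite (covers_meet wx) //.
  by apply: contra nx0 => /le_trans; apply; rewrite /o; lat.
have xe : x <= e by rewrite -xY0; lat.
have [lY0 lY1 lY2] : [/\ Y0 <= e, Y1 <= e & Y2 <= e].
  by rewrite !covers_le.
exists o, e, (Y1 `&` Y2), (Y0 `&` Y2), (Y0 `&` Y1), (o `|` x); split.
- exists (Y0 `&` Y1), Y0; split=> //.
  by rewrite meetC; exact: down.
- by split; split=> //; rewrite /o; lat.
- have [p0 p1 p2] : [/\ y0 <= Y1 `&` Y2, y1 <= Y0 `&` Y2 & y2 <= Y0 `&` Y1].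
    by rewrite /Y0 /Y1 /Y2; split; lat.
  have oe : o <= e by rewrite /o; lat.
  split; apply/le_anti/andP; split; try lat.
  + by rewrite -xY2; lat.
  + by rewrite -xY1; lat.
  + by rewrite -xY0; lat.
Qed.

(** The witness is [y `&` (x `|` (z `|` t))], and the equations are instances of
    the modular law.  In the last two, the property that the cut creates for
    [z] and [t] is seen to survive for the other pairs, so that it can be
    obtained for all three pairs by cutting one joinand after the other. *)
Lemma shrink w x y z t :
    w <= x -> w <= y -> x <= y `|` z `|` t ->
  exists y', [/\ w <= y', y' <= y, x `|` (z `|` t) = y' `|` z `|` t,
    x `|` (y `|` z) = y `|` z `|` t -> x `|` (y' `|` z) = y' `|` z `|` t &
    x `|` (y `|` t) = y `|` z `|` t -> x `|` (y' `|` t) = y' `|` z `|` t].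
Proof.
move=> wx wy xyzt; set s := x `|` (z `|` t).
have s_le : s <= y `|` z `|` t by rewrite /s leUx xyzt /=; lat.
have sE : s = (y `&` s) `|` z `|` t.
  rewrite -joinA joinC L_modular; last by rewrite /s; lat.
  by rewrite (joinC _ y) joinA meet_r.
have side r : r <= s -> x `|` (y `|` r) = y `|` z `|` t ->
    x `|` ((y `&` s) `|` r) = s.
  move=> rs xyr; rewrite joinCA joinC L_modular; last by rewrite /s; lat.
  have -> : x `|` r `|` y = y `|` z `|` t by rewrite -xyr -joinA (joinC r).
  by rewrite meet_r.
exists (y `&` s); rewrite -sE; split=> //.
- by rewrite /s; lat.
- by lat.
- by apply: side; rewrite /s; lat.
- by apply: side; rewrite /s; lat.
Qed.

(** By modularity, joining the [z]s with [w] keeps [x] off their pairwise joins,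
    as [u] meets each of these in an element below [w]. *)
Lemma failure_quadrangle :
  finite_length L -> ~ two_distributive L ->
  exists o e a b c f : L, quadrangle o e a b c f.
Proof.
move=> L_finite /existsNP[u /existsNP[z0 /existsNP[z1 /existsNP[z2]]]].
set v := u `&` _; set w := _ `|` _ => vNw.
have wv : w < v.
  have w_le : w <= v by rewrite /w /v; lat.
  by rewrite lt_neqAle w_le andbT; apply/eqP => /esym.
have [x wx xv] := exists_cover L_finite wv.
have [xu xz] : x <= u /\ x <= z0 `|` z1 `|` z2.
  by split; apply: le_trans xv _; rewrite /v; lat.
have wx_le := covers_le wx.
have skew y : u `&` y <= w -> ~~ (x <= w `|` y).
  move=> uyw; apply/negP => xy.
  suff xw : x <= w by have := lt_le_trans wx.1 xw; rewrite ltxx.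
  have -> : x = (w `|` y) `&` x by rewrite meet_r.
  by rewrite -L_modular // leUx lexx /=; apply: le_trans uyw; lat.
pose y0 := w `|` z0; pose y1 := w `|` z1; pose y2 := w `|` z2.
have n0 : ~~ (x <= y1 `|` y2).
  have -> : y1 `|` y2 = w `|` (z1 `|` z2) by rewrite /y1 /y2; lateq.
  by apply: skew; rewrite /w; lat.
have n1 : ~~ (x <= y0 `|` y2).
  have -> : y0 `|` y2 = w `|` (z0 `|` z2) by rewrite /y0 /y2; lateq.
  by apply: skew; rewrite /w; lat.
have n2 : ~~ (x <= y0 `|` y1).
  have -> : y0 `|` y1 = w `|` (z0 `|` z1) by rewrite /y0 /y1; lateq.
  by apply: skew; rewrite /w; lat.
have xy : x <= y0 `|` y1 `|` y2.
  by apply: le_trans xz _; rewrite /y0 /y1 /y2; lat.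
have [wy0 wy1 wy2] : [/\ w <= y0, w <= y1 & w <= y2].
  by rewrite /y0 /y1 /y2; split; lat.
move: y0 y1 y2 n0 n1 n2 xy wy0 wy1 wy2 => {xz} y0 y1 y2 n0 n1 n2 xy wy0 wy1 wy2.
have mono y z t : y <= z -> ~~ (x <= z `|` t) -> ~~ (x <= y `|` t).
  by move=> yz; apply: contra => /le_trans; apply; lat.
(* [Ji]: the joinands other than the [i]-th have with [x] the total join. *)
have [a0 [wa0 a0y J0 _ _]] := shrink wx_le wy0 xy.
have {xy} xy : x <= y1 `|` a0 `|` y2 by rewrite (joinC y1) -J0; lat.
have {n1} n1 := mono _ _ _ a0y n1; have {n2} n2 := mono _ _ _ a0y n2.
have [a1 [wa1 a1y J1 _ J01]] := shrink wx_le wy1 xy.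
have {J0 J01} J0 : x `|` (a1 `|` y2) = a1 `|` a0 `|` y2.
  by apply: J01; rewrite J0 (joinC a0).
have {n0} n0 := mono _ _ _ a1y n0.
rewrite joinC in n2; have {n2} n2 := mono _ _ _ a1y n2.
have {xy} xy : x <= y2 `|` a0 `|` a1.
  by apply: (@le_trans _ _ (x `|` (a0 `|` y2))); [lat|rewrite J1; lat].
have [a2 [wa2 a2y J2 J12 J02]] := shrink wx_le wy2 xy.
have E y : a1 `|` a0 `|` y = y `|` a0 `|` a1 by rewrite joinC joinA joinAC.
rewrite E in J0 J1.
have {J1 J12} J1 := J12 (etrans (congr1 _ (joinC _ _)) J1).
have {J0 J02} J0 := J02 (etrans (congr1 _ (joinC _ _)) J0).
rewrite joinC in n0; have {n0} n0 := mono _ _ _ a2y n0.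
rewrite joinC in n1; have {n1} n1 := mono _ _ _ a2y n1.
have E' : a2 `|` a0 `|` a1 = a0 `|` a1 `|` a2 by rewrite -joinA joinC.
apply: (coatoms_quadrangle wx wa0 wa1 wa2); rewrite -?E'.
- by rewrite joinC.
- by rewrite joinC.
- by rewrite joinC.
- by rewrite (joinC a1).
- by rewrite (joinC a0).
- by [].
Qed.

End Failure.

(** * Two maximal chains of different lengths *)

Section ShortChain.
Context {d : Order.disp_t} {T : porderType d}.

Lemma maximal_chain_covers (z x y e : T) :
    (forall t, z <= t) -> covers z x -> covers x y -> covers y e ->
  maximal_chain (principal_ideal e) [set` [:: z; x; y; e]]%classic.
Proof.
move=> z_min zx xy ye.
have s_lt : sorted <%O [:: z; x; y; e] by rewrite /= zx.1 xy.1 ye.1.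
have xe : x < e by apply: lt_trans xy.1 ye.1.
split; first exact: chain_sorted.
  move=> t /=; rewrite !inE /principal_ideal /= => /or4P[] /eqP -> //.
  - exact: ltW.
  - by case: ye => /ltW.
move=> D D_chain D_le CD; apply/seteqP; split=> // t Dt /=.
have Dx : D x by apply: CD; rewrite /= !inE eqxx orbT.
have Dy : D y by apply: CD; rewrite /= !inE eqxx !orbT.
suff : [\/ t = z, t = x, t = y | t = e].
  by case=> ->; rewrite !inE eqxx ?orbT.
have [tx|xt] := D_chain _ _ Dt Dx.
  by have [->|->] := zx.2 t (z_min t) tx; [apply: Or41|apply: Or42].
have [ty|yt] := D_chain _ _ Dt Dy.
  by have [->|->] := xy.2 t xt ty; [apply: Or42|apply: Or43].
have te : t <= e := D_le t Dt.
by have [->|->] := ye.2 t yt te; [apply: Or43|apply: Or44].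
Qed.

End ShortChain.

Section BottomOfRCSub.
Context {d : Order.disp_t} {L : latticeType d}.
Implicit Types x y o e : L.

Definition rcsub0 : RCSub L := rcsub (or_introl (erefl set0)).
Definition rcsub_itv x y : RCSub L := rcsub (itv_is_rcsub x y).
Definition rcsub_pair o e (oe : o < e) : RCSub L :=
  rcsub (pair_is_rcsub (ltW oe)).

Lemma rcsub_itvE x y z : rcsub_set (rcsub_itv x y) z = (x <= z <= y).
Proof. by []. Qed.

Lemma rcsub0_le S : rcsub0 <= S.
Proof. by rewrite rcsub_leE. Qed.

Lemma rcsub_itv_lt o x y : o <= x -> x < y -> rcsub_itv o x < rcsub_itv o y.
Proof.
move=> ox xy; apply: (@rcsub_ltP _ _ _ _ y).
- by move=> z; rewrite !rcsub_itvE => /andP[-> /le_trans->] //; exact: ltW.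
- by rewrite rcsub_itvE lexx andbT (le_trans ox) // ltW.
- by rewrite rcsub_itvE => /andP[_ /(lt_le_trans xy)]; rewrite ltxx.
Qed.

Lemma covers_rcsub0 o : covers rcsub0 (rcsub_itv o o).
Proof.
split=> [|S _]; first by apply: (@rcsub_ltP _ _ _ _ o); rewrite ?rcsub_itvE ?lexx.
rewrite rcsub_leE => So; have [oS|noS] := pselect (rcsub_set S o).
  right; apply: rcsub_inj; apply/seteqP; split=> // z /andP[oz zo].
  by have -> : z = o by lateq.
left; apply: rcsub_inj; apply/seteqP; split=> // z Sz.
have /andP[oz zo] := So z Sz; apply: noS.
by have -> : o = z by lateq.
Qed.

Lemma covers_rcsub_pair o e (oe : o < e) :
  covers (rcsub_itv o o) (rcsub_pair oe).
Proof.
split=> [|S].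
  apply: (@rcsub_ltP _ _ _ _ e); first by move=> z /andP[oz zo]; left; lateq.
  - by right.
  - by rewrite rcsub_itvE => /andP[_ /(lt_le_trans oe)]; rewrite ltxx.
rewrite !rcsub_leE => oS Soe.
have So : rcsub_set S o by apply: oS; rewrite rcsub_itvE lexx.
have [Se|nSe] := pselect (rcsub_set S e).
  by right; apply: rcsub_inj; apply/seteqP; split=> // z [] ->.
left; apply: rcsub_inj; apply/seteqP; split=> // z Sz.
by have [->|zE] := Soe z Sz; [rewrite rcsub_itvE lexx|rewrite zE in Sz].
Qed.

Lemma covers_quadrangle (o e a b c f : L) (oe : o < e) :
  modular L -> quadrangle o e a b c f ->
  covers (rcsub_pair oe) (rcsub_itv o e).
Proof.
move=> L_modular [oe_plane [pa pb pc pf] [abc abf acf bcf]].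
have [p [l [op pl le]]] := oe_plane.
have pe : p < e by apply: lt_trans pl.1 le.1.
split=> [|S].
  apply: (@rcsub_ltP _ _ _ _ p).
  - by move=> z [] ->; rewrite rcsub_itvE lexx ltW.
  - by rewrite rcsub_itvE !ltW ?op.1.
  - by case=> pE; [move: op.1|move: pe]; rewrite pE ltxx.
rewrite !rcsub_leE => oeS S_le.
have So : rcsub_set S o by apply: oeS; left.
have Se : rcsub_set S e by apply: oeS; right.
have S_rc : is_rcsub (rcsub_set S) := asboolW (rcsub_setP S).
have [Soe|/existsNP[x /not_implyP[Sx x_new]]] :=
    pselect (forall x, rcsub_set S x -> rcsub_set (rcsub_pair oe) x).
  by left; apply: rcsub_inj; apply/seteqP; split.
have /andP[ox xe] := S_le x Sx.
have {}ox : o < x.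
  by rewrite lt_neqAle ox andbT; apply/eqP => xo; apply: x_new; left.
have {}xe : x < e.
  by rewrite lt_neqAle xe andbT; apply/eqP => xo; apply: x_new; right.
right; apply: rcsub_inj; apply/seteqP; split=> // z /andP[oz ze].
exact: (quadrangle_mem L_modular oe_plane S_rc So Se pa pb pc pf
  abc abf acf bcf ox xe Sx).
Qed.

(** Below [[o, e]], the empty set, [{o}], [{o, e}] and [[o, e]] form a maximal
    chain, since each covers the preceding one, whereas the empty set and the
    intervals from [o] to the elements of a maximal chain of the plane form a
    chain with five elements. *)
Lemma quadrangle_not_ranked (o e a b c f : L) :
  modular L -> quadrangle o e a b c f -> ~ ranked (RCSub L).
Proof.
move=> L_modular quad L_ranked.
have [[p [l [op pl le]]] _ _] := quad.
have ol : o < l by apply: lt_trans op.1 pl.1.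
have oe : o < e by apply: lt_trans ol le.1.
have short : maximal_chain (principal_ideal (rcsub_itv o e))
    [set` [:: rcsub0; rcsub_itv o o; rcsub_pair oe; rcsub_itv o e]]%classic.
  apply: maximal_chain_covers.
  - exact: rcsub0_le.
  - exact: covers_rcsub0.
  - exact: covers_rcsub_pair.
  - exact: covers_quadrangle quad.
pose s := [:: rcsub0; rcsub_itv o o; rcsub_itv o p; rcsub_itv o l;
              rcsub_itv o e].
have s_lt : sorted <%O s.
  rewrite /= (covers_rcsub0 o).1 !rcsub_itv_lt ?op.1 ?pl.1 ?le.1 // ltW //.
  exact: op.1.
have s_le : ([set` s] `<=` principal_ideal (rcsub_itv o e))%classic.
  have itv_le x : x <= e -> rcsub_itv o x <= rcsub_itv o e.
    by move=> xe; rewrite rcsub_leE => z /= /andP[-> zx]; rewrite (le_trans zx).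
  move=> S /=; rewrite !inE /principal_ideal /=.
  move=> /orP[/eqP ->|/or4P[] /eqP ->] //; first exact: rcsub0_le.
  - by apply: itv_le; exact: ltW.
  - by apply: itv_le; rewrite ltW // (lt_trans pl.1) // le.1.
  - by apply: itv_le; exact: covers_le.
have [D sD maxD] := maximal_chain_extends s_le (chain_sorted s_lt).
have [n [short_n D_n]] := L_ranked _ _ _ short maxD.
have n4 : n.+1 = 4.
  apply/card_eq_II; apply: card_eq_trans (card_esym short_n) _.
  have short_lt : sorted <%O
      [:: rcsub0; rcsub_itv o o; rcsub_pair oe; rcsub_itv o e].
    by rewrite /= (covers_rcsub0 o).1 (covers_rcsub_pair oe).1
      (covers_quadrangle oe L_modular quad).1.
  exact: card_sorted short_lt.
have : (`I_5 #<= `I_n.+1)%card.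
  have s5 : ([set` s] #= `I_5)%card := card_sorted s_lt.
  by rewrite -(card_le_eqr D_n) -(card_le_eql s5); exact: subset_card_le.
by rewrite n4 card_le_II.
Qed.

End BottomOfRCSub.

Theorem theorem2 (d : Order.disp_t) (L : latticeType d)
  (L_modular : modular L)
  (RCSub_ranked : ranked (RCSub L))
  (RCSub_finite_length : finite_length (RCSub L)) :
  two_distributive L /\ finite_length L.
Proof.
have L_finite := finite_length_of_RCSub RCSub_finite_length.
split=> //; apply: contrapT => not_distr.
have [o [e [a [b [c [f quad]]]]]] :=
  failure_quadrangle L_modular L_finite not_distr.
exact: quadrangle_not_ranked quad RCSub_ranked.
Qed.
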